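(* Let $q=2^l$ with $l\ge 4$ an integer, and put $n=q+1$ and $a=\frac q2$. Then there exist asymmetric quantum convolutional codes with the following parameters, each for some memory $\mu^*$: (a) $[(n,\ 2i-2t-2,\ \mu^*;\ 6,\ (d_z)_f/(d_x)_f)]_q$, where $(d_z)_f\ge n-2i-1$ and $(d_x)_f\ge 2t+3$, for all positive integers $i,t$ such that $1\le t\le i-2$ and $3\le i\le a-1$; (b) $[(n,\ 2i-2t,\ \mu^*;\ 4,\ (d_z)_f/(d_x)_f)]_q$, where $(d_z)_f\ge n-2i-1$ and $(d_x)_f\ge 2t+3$, for all positive integers $i,t$ such that $1\le t\le i-1$ and $2\le i\le a-1$. (In both items the two lower bounds are interchanged if $2t+3>n-2i-1$.)
   Context: Convolutional notions. A matrix over $\mathbb F_q[D]$ is basic if it has a polynomial right inverse. The weight of $\mathbf v(D)\in\mathbb F_q[D]^n$ is the total number of nonzero coefficients of its $n$ components. The Euclidean dual of a submodule $V\subseteq\mathbb F_q[D]^n$ is $V^\perp=\{\mathbf u(D)\in\mathbb F_q[D]^n:\ \mathbf u(D)\mathbf v(1/D)^t=0\ \text{for all }\mathbf v(D)\in V\}$ (the superscript $t$ on vectors and matrices denotes transpose). Asymmetric quantum convolutional code (AQCC), CSS type. It is specified by a basic (hence full-rank) stabilizer matrix $$S(D)=\begin{pmatrix}A(D)&|&0\\0&|&B(D)\end{pmatrix},\quad A\in\mathbb F_q[D]^{r\times n},\ B\in\mathbb F_q[D]^{s\times n},\quad A(D)B(1/D)^t=0$$ (symplectic orthogonality). Let $\mathcal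 A,\mathcal B\subseteq\mathbb F_q[D]^n$ be the row modules of $A$ and $B$; then $\mathcal A\subseteq\mathcal B^\perp$ and $\mathcal B\subseteq\mathcal A^\perp$. The code has parameters $[(n,K,\mu^*;\gamma,(d_z)_f/(d_x)_f)]_q$, where: $n$ is the frame size; $K=n-r-s$ is the number of logical qudits per frame; $\mu^*$ is the memory, i.e. the maximal degree of an entry of $S(D)$; $\gamma$ is the degree, i.e. the overall constraint length (sum over the rows of $S(D)$ of the maximal degree in the row), required to be minimal among all basic matrices with the same row module; and, with $\operatorname{wt}(T)$ denoting the minimum weight of an element of $T$, $(d_z)_f$ and $(d_x)_f$ are respectively the maximum and the minimum of the two numbers $\operatorname{wt}(\mathcal B^\perp\setminus\mathcal A)$ and $\operatorname{wt}(\mathcal A^\perp\setminus\mathcal B)$. Convention: whenever the value (bound) given for $(d_x)_f$ is larger than the one given for $(d_z)_f$, the two are interchanged. Writing $\mu^*$ means that no claim is made about the value of the memory. *)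

(* Defs.v *)
From HB Require Import structures.
From mathcomp Require Import all_boot all_order all_algebra.

Set Implicit Arguments.
Unset Strict Implicit.
Unset Printing Implicit Defensive.

Import GRing.Theory.
Local Open Scope ring_scope.

Definition basic (F : finFieldType) (m n : nat) (G : 'M[{poly F}]_(m, n)) : Prop :=
  exists R : 'M[{poly F}]_(n, m), G *m R = 1%:M.

Definition row_module (F : finFieldType) (m n : nat) (G : 'M[{poly F}]_(m, n))
    (v : 'rV[{poly F}]_n) : Prop :=
  exists c : 'rV[{poly F}]_m, v = c *m G.

(* p(1/D), computed in the field F(D) because it is not a polynomial. *)
Definition subst_inv (F : finFieldType) (p : {poly F}) : {fraction {poly F}} :=
  (map_poly (fun c : F => tofrac (c%:P)) p).[(tofrac 'X)^-1].

(* U(D) V(1/D)^t = 0, an identity over F(D). *)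
Definition orthogonal_inv (F : finFieldType) (k m n : nat)
    (U : 'M[{poly F}]_(k, n)) (V : 'M[{poly F}]_(m, n)) : Prop :=
  map_mx (@tofrac {poly F}) U *m (map_mx (@subst_inv F) V)^T = 0.

Definition dual (F : finFieldType) (n : nat) (V : 'rV[{poly F}]_n -> Prop)
    (u : 'rV[{poly F}]_n) : Prop :=
  forall v : 'rV[{poly F}]_n, V v -> orthogonal_inv u v.

Definition weight (F : finFieldType) (n : nat) (v : 'rV[{poly F}]_n) : nat :=
  (\sum_(j < n) count (fun c : F => c != 0%R) (v ord0 j))%N.

(* The minimum is a relation: it has no value on the empty set. *)
Definition is_min_weight (F : finFieldType) (n : nat)
    (T : 'rV[{poly F}]_n -> Prop) (d : nat) : Prop :=
  (exists2 v, T v & weight v = d) /\ (forall v, T v -> (d <= weight v)%N).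

Definition row_degree (F : finFieldType) (m n : nat)
    (G : 'M[{poly F}]_(m, n)) (i : 'I_m) : nat :=
  (\max_(j < n) (size (G i j)).-1)%N.

Definition memory (F : finFieldType) (m n : nat) (G : 'M[{poly F}]_(m, n)) : nat :=
  (\max_(i < m) row_degree G i)%N.

Definition constraint_length (F : finFieldType) (m n : nat)
    (G : 'M[{poly F}]_(m, n)) : nat :=
  (\sum_(i < m) row_degree G i)%N.

Definition stabilizer (F : finFieldType) (r s n : nat)
    (A : 'M[{poly F}]_(r, n)) (B : 'M[{poly F}]_(s, n)) :
    'M[{poly F}]_(r + s, n + n) :=
  block_mx A 0 0 B.

Record is_AQCC (F : finFieldType) (n r s : nat)
    (A : 'M[{poly F}]_(r, n)) (B : 'M[{poly F}]_(s, n))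
    (K mu gamma dz dx : nat) : Prop := IsAQCC {
  aqcc_basic : basic (stabilizer A B);
  aqcc_orth : orthogonal_inv A B;
  aqcc_dim : (K + (r + s))%N = n;
  aqcc_memory : memory (stabilizer A B) = mu;
  aqcc_degree : constraint_length (stabilizer A B) = gamma;
  aqcc_minimal : forall (m : nat) (T : 'M[{poly F}]_(m, n + n)),
    basic T ->
    (forall v, row_module T v <-> row_module (stabilizer A B) v) ->
    (gamma <= constraint_length T)%N;
  aqcc_distances : exists d1 d2 : nat,
    [/\ is_min_weight (fun v => dual (row_module B) v /\ ~ row_module A v) d1,
        is_min_weight (fun v => dual (row_module A) v /\ ~ row_module B v) d2,
        dz = maxn d1 d2 & dx = minn d1 d2] }.

Definition AQCC_exists (F : finFieldType) (n K mu gamma dz dx : nat) : Prop :=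
  exists (r s : nat) (A : 'M[{poly F}]_(r, n)) (B : 'M[{poly F}]_(s, n)),
    is_AQCC A B K mu gamma dz dx.

(* Main.v *)
(** Identify the coordinates with the points of the projective line over F and let V_c be the
    space of forms of degree c, so that evaluation makes V_c an MDS code. Multiplication by an
    irreducible quadratic form N embeds V_(c-2) into V_c without changing the weights of dual
    words, which gives the nested MDS codes N^(m+1) V_(2t-1) < N^m V_(2t+1) < V_d, where d = 2i+1
    and m = i - t. Let b_j be a basis of F^n adapted to this chain and b'_j the dual basis.

    The rows of A are the b_j with j < 2t, to the first two of which D b_(2t) and D b_(2t+1) are
    added, so they lie in V_d[D]; B generates the dual of a similar module between A and V_d[D],
    and is explicit in terms of b'_j. A word of the dual of B has all its coefficients in V_d.
    A word of the dual of A has its highest coefficient orthogonal to N^(m+1) V_(2t-1) and its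
    lowest one orthogonal to b_(2t) and b_(2t+1); if the two coefficients coincide this word is
    in the dual of N^m V_(2t+1), and otherwise the two weights add up. *)
Require Import Defs.
From mathcomp Require Import all_boot all_order all_fingroup all_algebra.
From mathcomp Require Import zify ring.
From Stdlib Require Import Classical.

Set Implicit Arguments.
Unset Strict Implicit.
Unset Printing Implicit Defensive.

Import GRing.Theory.
Local Open Scope ring_scope.
Local Notation cst := (map_mx (@polyC _)).

(** * Weights of polynomial words through their coefficient vectors *)

Section Weights.
Variables (F : finFieldType) (n : nat).
Implicit Types (x y : 'rV[F]_n) (v : 'rV[{poly F}]_n).

Definition hamming x : nat := (\sum_(j < n) (x ord0 j != 0)%R)%N.

Definition coef_row (m : nat) v : 'rV[F]_n := \row_j (v ord0 j)`_m.

Lemma count_nz_coef (p : {poly F}) (N : nat) : (size p <= N)%N ->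
  count (fun c : F => c != 0) p = (\sum_(i < N) (p`_i != 0)%R)%N.
Proof.
move=> hN; rewrite -sum1_count (big_nth 0) big_mkord.
rewrite (big_ord_widen_cond _ (fun i => p`_i != 0) (fun=> 1%N) hN).
rewrite [RHS](bigID (fun i : 'I_N => p`_i != 0)) /= [X in (_ + X)%N]big1 ?addn0.
  rewrite big_mkcondr /=; apply: eq_bigr => i hi; rewrite hi.
  by case: ltnP => // /(nth_default 0) e; rewrite e eqxx in hi.
by move=> i /negbTE->.
Qed.

Lemma coef_row_weight m v : (hamming (coef_row m v) <= weight v)%N.
Proof.
apply: leq_sum => j _; rewrite mxE.
rewrite (@count_nz_coef _ (maxn (size (v ord0 j)) m.+1)) ?leq_maxl //.
have hm : (m < maxn (size (v ord0 j)) m.+1)%N by rewrite leq_maxr.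
by rewrite (bigD1 (Ordinal hm)) //= leq_addr.
Qed.

Lemma coef_row_weight2 l m v : l != m ->
  (hamming (coef_row l v) + hamming (coef_row m v) <= weight v)%N.
Proof.
move=> lm; rewrite -big_split /=; apply: leq_sum => j _; rewrite !mxE.
set N := maxn (size (v ord0 j)) (maxn l.+1 m.+1).
rewrite (@count_nz_coef _ N) ?leq_maxl //.
have hl : (l < N)%N by rewrite /N; lia.
have hm : (m < N)%N by rewrite /N; lia.
rewrite (bigD1 (Ordinal hl)) //= leq_add2l.
by rewrite (bigD1 (Ordinal hm)) ?leq_addr // -val_eqE /= eq_sym.
Qed.

Lemma coef_row_neq0 v : v != 0 -> exists m, coef_row m v != 0.
Proof.
move=> /eqP v0; apply: NNPP => h; apply: v0.
apply/rowP=> j; apply/polyP=> m; rewrite mxE coef0.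
have /eqP/rowP/(_ j) : coef_row m v == 0 by apply/negPn/negP => h'; apply: h; exists m.
by rewrite !mxE.
Qed.

Lemma coef_row_large v : exists N, forall m, (N <= m)%N -> coef_row m v = 0.
Proof.
exists (\max_(j < n) size (v ord0 j))%N => m hm; apply/rowP=> j; rewrite !mxE.
by rewrite nth_default // (leq_trans _ hm) // (leq_bigmax j).
Qed.

(** Descent on the weight of a known element; [classic] decides whether a lighter one exists, since
    [T] is an arbitrary predicate. *)
Lemma min_weight_exists (T : 'rV[{poly F}]_n -> Prop) (b : nat) :
  (exists v, T v) -> (forall v, T v -> (b <= weight v)%N) ->
  exists2 d, is_min_weight T d & (b <= d)%N.
Proof.
move=> [v]; move: {2}(weight v) (leqnn (weight v)) => N.
elim: N v => [|N IH] v hv Tv hb.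
  exists (weight v); last exact: hb.
  by split; [exists v|move=> w _; lia].
have [[w Tw hw]|h] := classic (exists2 w, T w & (weight w < weight v)%N).
  by apply: (IH w) => //; lia.
exists (weight v); last exact: hb.
split; first by exists v.
by move=> w Tw; rewrite leqNgt; apply/negP => hw; apply: h; exists w.
Qed.

Definition dot x y : F := \sum_j x ord0 j * y ord0 j.

Lemma dotC x y : dot x y = dot y x.
Proof. by apply: eq_bigr => j _; rewrite mulrC. Qed.

End Weights.

(** * Polynomial matrices of degree at most one and duality under D -> 1/D *)

Section Conv.
Variables (F : finFieldType).

Definition conv (m n : nat) (A0 A1 : 'M[F]_(m, n)) : 'M[{poly F}]_(m, n) :=
  cst A0 + 'X *: cst A1.

Lemma conv_mulC (m n k : nat) (A0 A1 : 'M[F]_(m, n)) (L : 'M[F]_(n, k)) :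
  conv A0 A1 *m cst L = conv (A0 *m L) (A1 *m L).
Proof. by rewrite /conv mulmxDl !map_mxM scalemxAl. Qed.

(** The hypotheses are the coefficients of 1, D and D^2 in the product; the second factor is the
    reversal of [conv B0 B1]. *)
Lemma conv_mul_tr (m n k : nat) (A0 A1 : 'M[F]_(m, n)) (B0 B1 : 'M[F]_(k, n)) :
  A0 *m B1^T = 0 -> A0 *m B0^T + A1 *m B1^T = 0 -> A1 *m B0^T = 0 ->
  conv A0 A1 *m (conv B1 B0)^T = 0.
Proof.
move=> h0 h1 h2; rewrite /conv linearD linearZ /= !map_trmx mulmxDr !mulmxDl.
rewrite -!scalemxAl -!scalemxAr -!map_mxM h0 h2 !map_mx0 !scaler0.
by rewrite add0r addr0 -scalerDr -map_mxD addrC h1 map_mx0 scaler0.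
Qed.

Lemma subst_invM (p q : {poly F}) : subst_inv (p * q) = subst_inv p * subst_inv q.
Proof.
rewrite /subst_inv.
(* The coefficient map is restated as a composite of ring morphisms, so that the morphism lemmas
   apply. *)
have -> : map_poly (fun c : F => tofrac c%:P) =1 map_poly (@tofrac {poly F} \o @polyC F).
  by [].
by rewrite rmorphM hornerM.
Qed.

Lemma subst_invD (p q : {poly F}) : subst_inv (p + q) = subst_inv p + subst_inv q.
Proof.
rewrite /subst_inv.
have -> : map_poly (fun c : F => tofrac c%:P) =1 map_poly (@tofrac {poly F} \o @polyC F).
  by [].
by rewrite rmorphD hornerD.
Qed.

Lemma subst_inv0 : subst_inv (0 : {poly F}) = 0.
Proof. by rewrite /subst_inv map_poly0 horner0. Qed.

Lemma subst_invC (c : F) : subst_inv c%:P = tofrac c%:P.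
Proof.
rewrite /subst_inv.
have -> : map_poly (fun c : F => tofrac c%:P) =1 map_poly (@tofrac {poly F} \o @polyC F).
  by [].
by rewrite map_polyC hornerC.
Qed.

Lemma subst_invX : subst_inv ('X : {poly F}) = (tofrac 'X)^-1.
Proof.
rewrite /subst_inv.
have -> : map_poly (fun c : F => tofrac c%:P) =1 map_poly (@tofrac {poly F} \o @polyC F).
  by [].
by rewrite map_polyX hornerX.
Qed.

Lemma tofracX_neq0 : tofrac ('X : {poly F}) != 0.
Proof. by rewrite tofrac_eq0 polyX_eq0. Qed.

(* Substituting 1/D in A0 + D A1 reverses it, up to the unit D of F(D). *)
Lemma orthogonal_conv (k m n : nat) (U : 'M[{poly F}]_(k, n)) (A0 A1 : 'M[F]_(m, n)) :
  orthogonal_inv U (conv A0 A1) <-> U *m (conv A1 A0)^T = 0.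
Proof.
rewrite /orthogonal_inv.
have -> : map_mx (@subst_inv F) (conv A0 A1)
   = (tofrac 'X)^-1 *: map_mx (@tofrac {poly F}) (conv A1 A0).
  apply/matrixP=> i j; rewrite !mxE subst_invD subst_invM subst_invX !subst_invC.
  by rewrite tofracD tofracM mulrDr mulKf ?tofracX_neq0 // addrC.
rewrite linearZ /= -scalemxAr map_trmx -map_mxM; split => [h|->]; last first.
  by rewrite map_mx0 scaler0.
move/eqP: h; rewrite scaler_eq0 invr_eq0 (negbTE tofracX_neq0) /= => /eqP h.
apply/matrixP=> i j; move/matrixP/(_ i j): h; rewrite mxE [RHS]mxE => /eqP.
by rewrite tofrac_eq0 => /eqP->; rewrite mxE.
Qed.

(** Testing the rows suffices, because [subst_inv] respects sums and products and so carries
    combinations of rows to combinations of rows. *)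
Lemma dual_row_module (m n : nat) (G : 'M[{poly F}]_(m, n)) (u : 'rV[{poly F}]_n) :
  dual (row_module G) u <-> orthogonal_inv u G.
Proof.
rewrite /dual /orthogonal_inv; split=> [h|h v [c ->]].
  apply/matrixP=> i j; rewrite [i]ord1.
  have /h/matrixP/(_ ord0 ord0) e : row_module G (row j G).
    by exists (delta_mx 0 j); rewrite -rowE.
  rewrite [RHS]mxE in e; rewrite [RHS]mxE -[RHS]e !mxE.
  by apply: eq_bigr => l _; rewrite !mxE.
have -> : map_mx (@subst_inv F) (c *m G)
    = map_mx (@subst_inv F) c *m map_mx (@subst_inv F) G.
  apply/matrixP=> i j; rewrite !mxE (big_morph _ subst_invD subst_inv0).
  by apply: eq_bigr => l _; rewrite !mxE subst_invM.
by rewrite trmx_mul mulmxA h mul0mx.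
Qed.

(** These are the coefficients of 1 and D^(l+1) in u (A1 + D A0)^t = 0; they link consecutive
    coefficients of [u]. *)
Lemma conv_dual_coef (m n : nat) (A0 A1 : 'M[F]_(m, n)) (u : 'rV[{poly F}]_n) :
  dual (row_module (conv A0 A1)) u -> forall i : 'I_m,
  dot (coef_row 0 u) (row i A1) = 0 /\
  forall l, dot (coef_row l.+1 u) (row i A1) + dot (coef_row l u) (row i A0) = 0.
Proof.
move=> /dual_row_module/orthogonal_conv/matrixP h i.
have {}h l : (\sum_j u ord0 j * ((A1 i j)%:P + 'X * (A0 i j)%:P))`_l = 0.
  suff <- : (u *m (conv A1 A0)^T) ord0 i
      = \sum_j u ord0 j * ((A1 i j)%:P + 'X * (A0 i j)%:P) by rewrite h mxE coef0.
  by rewrite mxE; apply: eq_bigr => j _; rewrite !mxE.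
split=> [|l].
  rewrite -[RHS](h 0%N) coef_sum /dot; apply: eq_bigr => j _.
  by rewrite !mxE mulrDr coefD coefMC mulrCA coefXM addr0.
rewrite -[RHS](h l.+1) coef_sum /dot -big_split; apply: eq_bigr => j _ /=.
by rewrite !mxE mulrDr coefD coefMC mulrCA coefXM coefMC.
Qed.

(** A certificate of non-membership: at D = 0 an element of the row module is a combination of the
    rows of [A0]. *)
Lemma conv_row_module_eval0 (m n : nat) (A0 A1 : 'M[F]_(m, n)) (v : 'rV[{poly F}]_n)
  (y : 'rV[F]_n) :
  row_module (conv A0 A1) v -> A0 *m y^T = 0 -> dot (coef_row 0 v) y = 0.
Proof.
move=> [c ->] h.
have -> : coef_row 0 (c *m conv A0 A1) = coef_row 0 c *m A0.
  apply/rowP=> j; rewrite !mxE coef_sum; apply: eq_bigr => i _.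
  by rewrite !mxE mulrDr coefD coefMC mulrCA coefXM addr0.
have : (coef_row 0 c *m A0 *m y^T) ord0 ord0 = 0 by rewrite -mulmxA h mulmx0 mxE.
by rewrite mxE => e; rewrite -[RHS]e /dot; apply: eq_bigr => j _; rewrite !mxE.
Qed.

End Conv.

(** * A determinantal lower bound for the constraint length *)

Section Minimality.
Variable F : finFieldType.

Lemma prod_size_leq (m : nat) (E : 'I_m -> {poly F}) (d : 'I_m -> nat) :
  (forall i, (size (E i) <= (d i).+1)%N) ->
  (size (\prod_i E i)%R <= (\sum_i d i).+1)%N.
Proof.
move=> h; elim/big_ind2: _ => //; first by rewrite size_poly1.
by move=> a p b q hp hq; have := size_polyMleq p q; lia.
Qed.

Lemma size_det_leq (m : nat) (Q : 'M[{poly F}]_m) (d : 'I_m -> nat) :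
  (forall i j, (size (Q i j) <= (d i).+1)%N) ->
  (size (\det Q)%R <= (\sum_i d i).+1)%N.
Proof.
move=> h; rewrite /determinant; apply: (leq_trans (size_sum _ _ _)).
apply/bigmax_leqP=> s _.
have -> : (-1) ^+ odd_perm s * \prod_i Q i (s i)
   = ((-1) ^+ odd_perm s : F) *: \prod_i Q i (s i).
  by rewrite -mul_polyC rmorphXn rmorphN1.
by apply: (leq_trans (size_scale_leq _ _)); apply: prod_size_leq.
Qed.

Lemma size_mul_const (m n k : nat) (T : 'M[{poly F}]_(m, n)) (L : 'M[F]_(n, k)) i j :
  (size ((T *m cst L) i j)%R <= (row_degree T i).+1)%N.
Proof.
rewrite mxE; apply: (leq_trans (size_sum _ _ _)); apply/bigmax_leqP=> l _.
rewrite mxE mulrC mul_polyC; apply: (leq_trans (size_scale_leq _ _)).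
by apply: (leq_trans (leqSpred _)); rewrite ltnS; apply: (leq_bigmax l).
Qed.

Lemma row_module_submx (m k n : nat) (G : 'M[{poly F}]_(m, n)) (T : 'M[{poly F}]_(k, n)) :
  (forall v, row_module T v -> row_module G v) -> exists U, T = U *m G.
Proof.
move=> h.
have h' i : exists c : 'rV_m, row i T == c *m G.
  have /h [c e] : row_module T (row i T) by exists (delta_mx 0 i); rewrite -rowE.
  by exists c; rewrite e.
exists (\matrix_i xchoose (h' i)); apply/row_matrixP=> i.
by rewrite row_mul rowK -(eqP (xchooseP (h' i))).
Qed.

(** Basic matrices with the same row module differ by a unimodular factor, so the determinants of G
    L and T L agree up to a nonzero constant; by the Leibniz expansion the degree of the latter is
    at most the sum of the row degrees of [T]. *)
Lemma constraint_length_min (m k n : nat) (G : 'M[{poly F}]_(m, n))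
    (T : 'M[{poly F}]_(k, n)) (L : 'M[F]_(n, m)) :
  basic G -> basic T -> (forall v, row_module T v <-> row_module G v) ->
  ((size (\det (G *m cst L))%R).-1 <= constraint_length T)%N.
Proof.
move=> [R hR] [R' hR'] h.
have [U eU] : exists U, T = U *m G by apply: row_module_submx => v /h.
have [V eV] : exists V, G = V *m T by apply: row_module_submx => v /h.
have VU : V *m U = 1%:M by rewrite -[LHS]mulmx1 -hR mulmxA -(mulmxA V) -eU -eV.
have UV : U *m V = 1%:M by rewrite -[LHS]mulmx1 -hR' mulmxA -(mulmxA U) -eV -eU.
have km : k = m by apply/eqP; rewrite eqn_leq (mulmx1_min UV) (mulmx1_min VU).
subst k.
have sV : size (\det V) == 1%N.
  have : size (\det V * \det U) == 1%N by rewrite -det_mulmx VU det1 size_poly1.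
  by rewrite size_mul_eq1 => /andP[].
have -> : size (\det (G *m cst L)) = size (\det (T *m cst L)).
  rewrite eV -mulmxA det_mulmx; have /size_poly1P[c c0 ->] := sV.
  by rewrite size_Cmul.
have := @size_det_leq _ (T *m cst L) (row_degree T) (fun i j => size_mul_const T L i j).
by rewrite /constraint_length; case: size.
Qed.
End Minimality.

(** * Encoders assembled from a basis and its dual basis *)

Section Encoders.
Variables (F : finFieldType) (n : nat).
Implicit Types (b : nat -> 'rV[F]_n) (f g : nat -> nat).

Definition biorthogonal b b' :=
  forall i j, (i < n)%N -> (j < n)%N -> dot (b i) (b' j) = (i == j)%:R.

Lemma biorthogonalC b b' : biorthogonal b b' -> biorthogonal b' b.
Proof. by move=> h i j hi hj; rewrite dotC h // eq_sym. Qed.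

(** The zero rows from [w] on give the constant part and the D-part of an encoder the same shape. *)
Definition select (m w : nat) (c : F) f b : 'M[F]_(m, n) :=
  \matrix_(i < m, j < n) if (i < w)%N then c * b (f i) ord0 j else 0.

Lemma mul_select m w c f m' w' c' g b b' : biorthogonal b b' ->
  (forall i, (i < m)%N -> (i < w)%N -> (f i < n)%N) ->
  (forall i, (i < m')%N -> (i < w')%N -> (g i < n)%N) ->
  select m w c f b *m (select m' w' c' g b')^T =
  \matrix_(i < m, j < m')
    if (i < w)%N && (j < w')%N then c * c' * (f i == g j)%:R else 0.
Proof.
move=> bb hf hg; apply/matrixP=> i j; rewrite !mxE.
case: (ltnP i w) => hi /=; last by rewrite big1 // => l _; rewrite !mxE ltnNge hi mul0r.
case: (ltnP j w') => hj /=; last first.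
  by rewrite big1 // => l _; rewrite !mxE [X in _ * X]ifN ?mulr0 // -leqNgt.
rewrite -bb ?hf ?hg // mulr_sumr; apply: eq_bigr => l _.
by rewrite !mxE hi hj mulrACA.
Qed.

Definition encoder (m w : nat) (c : F) f g b : 'M[{poly F}]_(m, n) :=
  conv (select m m 1 f b) (select m w c g b).

Lemma row_degree_encoder m w c f g b i :
  (row_degree (encoder m w c f g b) i <= (i < w))%N.
Proof.
apply/bigmax_leqP=> j _; rewrite !mxE.
case: (ltnP i w) => hi /=; last by rewrite mulr0 addr0 -subn1 leq_subLR size_polyC leq_b1.
rewrite -subn1 leq_subLR (leq_trans (size_polyD _ _)) // geq_max.
rewrite (leq_trans (size_polyC_leq1 _)) // mulrC mul_polyC.
by rewrite (leq_trans (size_scale_leq _ _)) // size_polyX.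
Qed.

Section Basis.
Variables (b b' : nat -> 'rV[F]_n) (m w : nat) (c : F) (f g : nat -> nat).
Hypothesis bb : biorthogonal b b'.
Hypotheses (wm : (w <= m)%N) (c0 : c != 0).
Hypothesis f_lt : forall i, (i < m)%N -> (f i < n)%N.
Hypothesis g_lt : forall i, (i < w)%N -> (g i < n)%N.
Hypothesis f_inj : forall i j, (i < m)%N -> (j < m)%N -> f i = f j -> i = j.
Hypothesis g_inj : forall i j, (i < w)%N -> (j < w)%N -> g i = g j -> i = j.
Hypothesis fg : forall i j, (i < m)%N -> (j < w)%N -> f i <> g j.

(** The vectors b'_(f j) pair to the identity with the constant parts, and the D-parts vanish on
    them because [f] and [g] never meet. *)
Lemma encoder_right_inverse :
  encoder m w c f g b *m cst (select m m 1 f b')^T = 1%:M.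
Proof.
rewrite conv_mulC !(mul_select _ _ bb); try by move=> i *; auto.
apply/matrixP=> i j; rewrite !mxE !ltn_ord /= andbT !mul1r.
have -> : (if (i < w)%N then c * 1 * (g i == f j)%:R else 0) = 0 :> F.
  case: ltnP => // hi; case: eqP => [/esym/fg[]//|_]; by rewrite ?mulr0.
rewrite polyC0 mulr0 addr0; have -> : (f i == f j) = (i == j).
  by apply/eqP/eqP => [/f_inj e|->//]; apply/val_inj/e.
by rewrite rmorph_nat.
Qed.

(** [L] collects the duals of the leading vectors, b'_(g j) for j < w and b'_(f j) afterwards; the
    product is then diagonal with [w] entries c D and the others 1. Its degree [w] is what
    [constraint_length_min] needs. *)
Lemma encoder_det : exists L : 'M[F]_(n, m),
  size (\det (encoder m w c f g b *m cst L)) = w.+1.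
Proof.
pose h i := if (i < w)%N then g i else f i.
exists (select m m 1 h b')^T.
have -> : encoder m w c f g b *m cst (select m m 1 h b')^T =
   diag_mx (\row_i if (i < w)%N then c *: 'X else 1).
  have h_lt i : (i < m)%N -> (h i < n)%N by rewrite /h; case: ifP => *; auto.
  rewrite conv_mulC !(mul_select _ _ bb); try by move=> i *; auto.
  apply/matrixP=> i j; rewrite !mxE !ltn_ord /= andbT !mul1r mulr1.
  have [<-|ij] := eqVneq i j; rewrite ?mulr1n ?mulr0n.
    rewrite /h; case: (ltnP i w) => hi; last by rewrite eqxx polyC0 mulr0 addr0.
    have -> : (f i == g i) = false by apply/eqP/fg.
    by rewrite eqxx mulr1 polyC0 add0r mulrC mul_polyC.
  have -> : (f i == h j) = false.
    apply/negbTE/eqP; rewrite /h; case: (ltnP j w) => hj; first exact: fg.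
    by move/f_inj => e; case/eqP: ij; apply/val_inj/e.
  have -> : (if (i < w)%N then c * (g i == h j)%:R else 0) = 0 :> F.
    case: (ltnP i w) => // hi; have -> : (g i == h j) = false; last by rewrite mulr0.
    apply/negbTE/eqP; rewrite /h; case: (ltnP j w) => hj; last by move/esym/fg; apply.
    by move/g_inj => e; case/eqP: ij; apply/val_inj/e.
  by rewrite !polyC0 mulr0 addr0.
rewrite det_diag (eq_bigr (fun i : 'I_m => if (i < w)%N then c *: 'X else 1)); last first.
  by move=> i _; rewrite mxE.
rewrite -big_mkcond -(big_ord_widen m (fun=> c *: 'X) wm) prodr_const card_ord.
by rewrite exprZn size_scale ?expf_neq0 // size_polyXn.
Qed.

End Basis.

(** The two disjointness conditions kill the extreme coefficients of the product; the last condition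
    cancels the middle one, where constant parts meet constant parts and D-parts meet D-parts. *)
Lemma mul_encoder_tr m w c f g m' w' c' f' g' b b' : biorthogonal b b' ->
  (w <= m)%N -> (w' <= m')%N ->
  (forall i, (i < m)%N -> (f i < n)%N) -> (forall i, (i < w)%N -> (g i < n)%N) ->
  (forall i, (i < m')%N -> (f' i < n)%N) -> (forall i, (i < w')%N -> (g' i < n)%N) ->
  (forall i j, (i < m)%N -> (j < w')%N -> f i <> g' j) ->
  (forall i j, (i < w)%N -> (j < m')%N -> g i <> f' j) ->
  (forall i j, (i < m)%N -> (j < m')%N ->
     (f i == f' j)%:R
     + (if (i < w)%N && (j < w')%N then c * c' * (g i == g' j)%:R else 0) = 0 :> F) ->
  orthogonal_inv (encoder m w c f g b) (encoder m' w' c' f' g' b').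
Proof.
move=> bb wm wm' hf hg hf' hg' h1 h2 h3; apply/orthogonal_conv/conv_mul_tr;
  rewrite !(mul_select _ _ bb); try by move=> i *; auto.
- apply/matrixP=> i j; rewrite !mxE ltn_ord /=; case: ifP => // hj.
  by have /eqP/negbTE-> := h1 i j (ltn_ord i) hj; rewrite mulr0.
- by apply/matrixP=> i j; rewrite !mxE !ltn_ord /= !mul1r h3.
- apply/matrixP=> i j; rewrite !mxE ltn_ord andbT; case: ifP => // hi.
  by have /eqP/negbTE-> := h2 i j hi (ltn_ord j); rewrite mulr0.
Qed.

End Encoders.

(** * Block-diagonal stabilizer matrices *)

Section Stabilizers.
Variables (F : finFieldType) (n : nat).

Lemma sum_ltn (m w : nat) : (w <= m)%N -> (\sum_(i < m) (i < w) = w)%N.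
Proof.
move=> wm; rewrite (eq_bigr (fun i : 'I_m => if (i < w)%N then 1%N else 0%N)).
  by rewrite -big_mkcond -(big_ord_widen m (fun=> 1%N) wm) sum1_card card_ord.
by move=> i _; case: (i < w)%N.
Qed.

Lemma basic_stabilizer r s (A : 'M[{poly F}]_(r, n)) (B : 'M[{poly F}]_(s, n)) :
  basic A -> basic B -> basic (stabilizer A B).
Proof.
move=> [R hR] [R' hR']; exists (block_mx R 0 0 R').
by rewrite mulmx_block !mulmx0 !mul0mx hR hR' !addr0 !add0r -scalar_mx_block.
Qed.

Lemma stabilizer_det r s (A : 'M[{poly F}]_(r, n)) (B : 'M[{poly F}]_(s, n))
    (L : 'M[F]_(n, r)) (L' : 'M[F]_(n, s)) a c :
  size (\det (A *m cst L)) = a.+1 -> size (\det (B *m cst L')) = c.+1 ->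
  size (\det (stabilizer A B *m cst (block_mx L 0 0 L'))) = (a + c).+1.
Proof.
move=> hA hB; rewrite map_block_mx !map_mx0 mulmx_block !mulmx0 !mul0mx !addr0 !add0r.
rewrite det_ublock size_mul -?size_poly_gt0 ?hA ?hB //=; lia.
Qed.

Lemma constraint_length_stabilizer r s (A : 'M[{poly F}]_(r, n))
    (B : 'M[{poly F}]_(s, n)) (a c : nat) :
  (a <= r)%N -> (c <= s)%N ->
  (forall i, row_degree A i <= (i < a))%N -> (forall i, row_degree B i <= (i < c))%N ->
  (constraint_length (stabilizer A B) <= a + c)%N.
Proof.
move=> ar cs hA hB; rewrite /constraint_length big_split_ord /=.
rewrite -(sum_ltn ar) -(sum_ltn cs); apply: leq_add; apply: leq_sum => i _.
  apply: leq_trans (hA i); apply/bigmax_leqP=> j _.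
  rewrite -(splitK j); case: (split j) => j' /=; last by rewrite block_mxEur mxE size_poly0.
  by rewrite block_mxEul (leq_bigmax j').
apply: leq_trans (hB i); apply/bigmax_leqP=> j _.
rewrite -(splitK j); case: (split j) => j' /=; first by rewrite block_mxEdl mxE size_poly0.
by rewrite block_mxEdr (leq_bigmax j').
Qed.

Lemma dot_row_select (m w : nat) c f (b : nat -> 'rV[F]_n) (x : 'rV[F]_n) (i : 'I_m) :
  dot x (row i (select m w c f b)) = if (i < w)%N then c * dot x (b (f i)) else 0.
Proof.
rewrite /dot; case: ifP => hi; last by rewrite big1 // => l _; rewrite !mxE hi mulr0.
by rewrite mulr_sumr; apply: eq_bigr => l _; rewrite !mxE hi mulrCA.
Qed.

End Stabilizers.

(** * The quantum code attached to a basis with prescribed distances *)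

Section CSS.
Variables (F : finFieldType) (n t e rho zeta : nat) (b b' : nat -> 'rV[F]_n).
Let k := (2 * t + 2 + 2 * e + rho)%N.
Hypotheses (nE : n = (k + zeta)%N) (t0 : (0 < t)%N) (K0 : (0 < e + rho)%N).
Hypothesis bb : biorthogonal b b'.
Hypothesis dist_code : forall x, x != 0 ->
  (forall z, (k <= z < n)%N -> dot x (b' z) = 0) -> (n - k + 1 <= hamming x)%N.
Hypothesis dist_dual : forall x, x != 0 ->
  (forall j, (j < 2 * t + 2)%N -> dot x (b j) = 0) -> (2 * t + 3 <= hamming x)%N.
Hypothesis dist_dual_low : forall x, x != 0 ->
  (forall j, (j < 2 * t)%N -> dot x (b j) = 0) -> (2 * t + 1 <= hamming x)%N.
Hypothesis dist_dual_high : forall x, x != 0 ->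
  dot x (b (2 * t)%N) = 0 -> dot x (b (2 * t + 1)%N) = 0 -> (2 <= hamming x)%N.

(** The indices split into consecutive blocks: [0, 2t) for the constant parts of [A]; 2t and 2t+1
    for its D-parts; [e] indices for constant parts and [e] for D-parts of further rows of [B];
    [rho] free ones; and [k, n) for the constant rows of [B]. *)
Let fB i := if (i < 2)%N then i else if (i < 2 + e)%N then (2 * t + i)%N
            else (k + (i - 2 - e))%N.
Let gB i := if (i < 2)%N then (2 * t + i)%N else (2 * t + e + i)%N.
Let r := (2 * t)%N.
Let s := (2 + e + zeta)%N.
Let gA i := (2 * t + i)%N.
Let A := encoder r 2 1 id gA b.
Let B := encoder s (2 + e) (-1) fB gB b'.

Let fB_lt i : (i < s)%N -> (fB i < n)%N.
Proof. by rewrite nE /fB /s /k; do ?[case: ifP => ?]; lia. Qed.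
Let gB_lt i : (i < 2 + e)%N -> (gB i < n)%N.
Proof. by rewrite nE /gB /k; case: ifP => ?; lia. Qed.
Let fA_lt i : (i < r)%N -> (id i < n)%N.
Proof. by rewrite nE /k /r /=; lia. Qed.
Let gA_lt i : (i < 2)%N -> (gA i < n)%N.
Proof. by rewrite nE /k /gA; lia. Qed.
Let fB_inj i j : (i < s)%N -> (j < s)%N -> fB i = fB j -> i = j.
Proof. by rewrite /fB /s /k; do ?[case: ifP => ?]; lia. Qed.
Let gB_inj i j : (i < 2 + e)%N -> (j < 2 + e)%N -> gB i = gB j -> i = j.
Proof. by rewrite /gB; do ?[case: ifP => ?]; lia. Qed.
Let fgB i j : (i < s)%N -> (j < 2 + e)%N -> fB i <> gB j.
Proof. by rewrite /fB /gB /s /k; do ?[case: ifP => ?]; lia. Qed.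
Let fA_inj i j : (i < r)%N -> (j < r)%N -> id i = id j -> i = j.
Proof. by []. Qed.
Let gA_inj i j : (i < 2)%N -> (j < 2)%N -> gA i = gA j -> i = j.
Proof. by rewrite /gA; lia. Qed.
Let fgA i j : (i < r)%N -> (j < 2)%N -> id i <> gA j.
Proof. by rewrite /r /gA /=; lia. Qed.
Let wA : (2 <= r)%N. Proof. by rewrite /r; lia. Qed.
Let wB : (2 + e <= s)%N. Proof. by rewrite /s; lia. Qed.
Let bb' := biorthogonalC bb.

Let basicA : basic A.
Proof. by eexists; apply: encoder_right_inverse bb fA_lt gA_lt fA_inj fgA. Qed.
Let basicB : basic B.
Proof. by eexists; apply: encoder_right_inverse bb' fB_lt gB_lt fB_inj fgB. Qed.

Let orthAB : orthogonal_inv A B.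
Proof.
apply: (mul_encoder_tr bb) => //.
- by move=> i j; rewrite /r /gB /=; case: ifP => ?; lia.
- by move=> i j; rewrite /s /gA /fB /k /=; do ?[case: ifP => ?]; lia.
move=> i j hi hj.
(* Among the rows with index coincidences that count, both row numbers are equal and less than 2;
   there the constant parts contribute 1 and the D-parts -1. *)
have -> : (id i == fB j) = (i == j) && (j < 2)%N.
  by move: hi hj; rewrite /r /s /fB /k /=; do ?[case: ifP => ?]; lia.
have -> : (gA i == gB j) = (i == j) && (j < 2)%N || (2 <= j)%N && (i == e + j)%N.
  by move: hi hj; rewrite /r /s /gA /gB /k /=; case: ifP => ?; lia.
case: (ltnP i 2) => hi2 /=; last first.
  by rewrite addr0 (_ : _ && _ = false) //; lia.
case: (ltnP j 2) => hj2 /=.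
  by rewrite andbT orbF ltn_addr // mul1r; case: eqP; rewrite ?mulr1 ?subrr // mulr0 addr0.
rewrite andbF add0r (_ : (i == e + j)%N = false) ?mulr0 ?if_same //; lia.
Qed.

(** The last [zeta] rows of [B] are the constants b'_z with k <= z < n, so each coefficient of [u]
    satisfies the condition in [dist_code]. *)
Let distB u : dual (row_module B) u -> u != 0 -> (n - k + 1 <= weight u)%N.
Proof.
move=> hu /coef_row_neq0[l hl]; apply: leq_trans (coef_row_weight l u).
apply: dist_code hl _ => z hz.
have hs : (2 + e + (z - k) < s)%N by rewrite /s; lia.
have [h0 h1] := conv_dual_coef hu (Ordinal hs).
have := h1 l; rewrite !dot_row_select hs /= ltnNge leq_addr /= add0r mul1r.
by rewrite /fB !ifN -?leqNgt; [move=> <-; congr (dot _ (b' _)); lia | lia..].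
Qed.

Let distA u : dual (row_module A) u -> u != 0 -> (2 * t + 3 <= weight u)%N.
Proof.
move=> hu u0.
(* Row j of [A] ties coefficient l against b_j to coefficient l+1 against b_(2t+j); from j = 2 on
   there is no D-part. *)
have coefA l j : (j < 2 * t)%N -> dot (coef_row l u) (b j)
    = - (if (j < 2)%N then dot (coef_row l.+1 u) (b (2 * t + j)) else 0).
  move=> hj; have [_ /(_ l)] := conv_dual_coef hu (Ordinal hj).
  rewrite !dot_row_select hj !mul1r /= => /eqP; rewrite addrC addr_eq0 => /eqP.
  by [].
have coef0 j : (j < 2)%N -> dot (coef_row 0 u) (b (2 * t + j)) = 0.
  move=> hj; have hj' : (j < 2 * t)%N by lia.
  have [+ _] := conv_dual_coef hu (Ordinal hj').
  by rewrite !dot_row_select hj mul1r.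
have [N hN] := coef_row_large u.
have ex0 := coef_row_neq0 u0.
have hbound l : coef_row l u != 0 -> (l <= N)%N.
  by move=> h; rewrite leqNgt; apply/negP => /ltnW/hN e0; rewrite e0 eqxx in h.
pose lo := ex_minn ex0; pose hi := ex_maxn ex0 hbound.
have [lo0 lomin] : coef_row lo u != 0 /\ forall l, coef_row l u != 0 -> (lo <= l)%N.
  by rewrite /lo; case: ex_minnP.
have [hi0 himax] : coef_row hi u != 0 /\ forall l, coef_row l u != 0 -> (l <= hi)%N.
  by rewrite /hi; case: ex_maxnP.
(* The coefficient after [hi] is zero, so the right side of [coefA] vanishes. *)
have hiz j : (j < 2 * t)%N -> dot (coef_row hi u) (b j) = 0.
  move=> hj; rewrite coefA //; case: ifP => _; last by rewrite oppr0.
  have -> : coef_row hi.+1 u = 0.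
    by apply/eqP/negPn/negP => /himax; rewrite ltnn.
  by rewrite /dot big1 ?oppr0 // => l _; rewrite mxE mul0r.
(* Either [lo] is 0 and the boundary relation applies, or the coefficient before [lo] is zero and
   [coefA] is read from right to left. *)
have loz j : (j < 2)%N -> dot (coef_row lo u) (b (2 * t + j)) = 0.
  move=> hj; case elo : lo => [|l]; first exact: coef0.
  have hj' : (j < 2 * t)%N by lia.
  have := coefA l j hj'; rewrite hj.
  have -> : coef_row l u = 0.
    by apply/eqP/negPn/negP => /lomin; rewrite elo ltnn.
  rewrite /dot big1; first by move/eqP; rewrite eq_sym oppr_eq0 => /eqP.
  by move=> i _; rewrite mxE mul0r.
have [e1|lohi] := eqVneq lo hi.
  apply: leq_trans (coef_row_weight hi u); apply: dist_dual => // j hj.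
  have [hj'|hj'] := ltnP j (2 * t); first exact: hiz.
  rewrite -e1 (_ : j = 2 * t + (j - 2 * t))%N; last by lia.
  by apply: loz; lia.
(* The highest coefficient contributes 2t+1 and the lowest 2. *)
apply: leq_trans (coef_row_weight2 u lohi).
have := dist_dual_low hi0 hiz.
have := dist_dual_high lo0 _ (loz 1%N isT).
by rewrite -[X in b X]addn0 loz // => /(_ erefl); lia.
Qed.

Let dot_neq (c c' : nat -> 'rV[F]_n) i j : biorthogonal c c' ->
  (i < n)%N -> (j < n)%N -> i <> j -> dot (c i) (c' j) = 0.
Proof. by move=> h hi hj /eqP ij; rewrite h // (negbTE ij). Qed.

(* A logical operator: it commutes with every row of [B], and its value at D = 0 is b_(2t+2),
   which is not a combination of the values at D = 0 of the rows of [A]. *)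
Let logicalB : exists v, dual (row_module B) v /\ ~ row_module A v.
Proof.
(* For e > 0 the row b'_(2t+2) - D b'_(2t+2+e) of [B] meets b_(2t+2), and the term D b_(2t+2+e)
   cancels this; for e = 0 the width is 0 and [v] is constant. *)
pose v := encoder 1 (0 < e)%N 1 (fun=> 2 * t + 2)%N (fun=> 2 * t + 2 + e)%N b.
have hk : (2 * t + 2 < n)%N by rewrite nE /k; lia.
exists v; split.
  apply/dual_row_module; apply: (mul_encoder_tr bb) => //.
  - by case: (e).
  - by move=> i; rewrite nE /k; lia.
  - by move=> i j _; rewrite /gB; case: ifP; lia.
  - by move=> i j hi; rewrite /fB /k; do ?[case: ifP => ?]; lia.
  move=> i j hi hj.
  have -> : (2 * t + 2 == fB j)%N = (j == 2) && (0 < e)%N.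
    by move: hi hj; rewrite /s /fB /k; do ?[case: ifP => ?]; lia.
  have -> : (2 * t + 2 + e == gB j)%N = (j == 2).
    by move: hi hj; rewrite /gB; case: ifP => ?; lia.
  case: (posnP e) => [->|he] /=; first by rewrite andbF addr0.
  rewrite andbT; have -> : (i < 1)%N by [].
  case: (eqVneq j 2) => [->|_]; last by rewrite mulr0 if_same addr0.
  by rewrite (_ : 2 < 2 + e)%N ?mul1r ?mulr1 ?subrr //; lia.
move=> hv; have := conv_row_module_eval0 (y := b' (2 * t + 2)%N) hv.
have -> : coef_row 0 v = b (2 * t + 2)%N.
  by apply/rowP=> j; rewrite !mxE coefD coefC coefXM addr0 mul1r.
rewrite bb // eqxx => h; move/eqP: (oner_neq0 F); apply; apply: h.
have h0 (i : 'I_r) : dot (b i) (b' (2 * t + 2)%N) = 0.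
  apply: (dot_neq bb _ hk); first exact: fA_lt (ltn_ord i).
  by move: (ltn_ord i); rewrite /r; lia.
apply/matrixP=> i j; rewrite [RHS]mxE -[RHS](h0 i) mxE.
by rewrite [j]ord1; apply: eq_bigr => l _; rewrite !mxE ltn_ord mul1r.
Qed.

(** The constant word b'_(2t+2+e) works: [A] does not use this index, and it is not a value of [fB],
    so the rows of [B] at D = 0 cannot produce it. It lies below [k] because e + rho > 0. *)
Let logicalA : exists v, dual (row_module A) v /\ ~ row_module B v.
Proof.
pose v := encoder 1 0 1 (fun=> 2 * t + 2 + e)%N id b'.
have hk : (2 * t + 2 + e < n)%N by rewrite nE /k; lia.
exists v; split.
  apply/dual_row_module; apply: (mul_encoder_tr bb') => //.
  - by move=> i j _; rewrite /gA; lia.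
  - move=> i j hi hj; rewrite addr0 (_ : (_ == _) = false) //.
    by move: hj; rewrite /r; lia.
move=> hv; have := conv_row_module_eval0 (y := b (2 * t + 2 + e)%N) hv.
have -> : coef_row 0 v = b' (2 * t + 2 + e)%N.
  by apply/rowP=> j; rewrite !mxE coefD coefC coefXM addr0 mul1r.
rewrite bb' // eqxx => h; move/eqP: (oner_neq0 F); apply; apply: h.
have h0 (i : 'I_s) : dot (b' (fB i)) (b (2 * t + 2 + e)%N) = 0.
  apply: (dot_neq bb' _ hk); first exact: fB_lt (ltn_ord i).
  by move: (ltn_ord i); rewrite /s /fB /k; do ?[case: ifP => ?]; lia.
apply/matrixP=> i j; rewrite [RHS]mxE -[RHS](h0 i) mxE.
by rewrite [j]ord1; apply: eq_bigr => l _; rewrite !mxE ltn_ord mul1r.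
Qed.

Lemma css_code : exists mu dz dx : nat,
  [/\ AQCC_exists F n (e + rho) mu (4 + e) dz dx,
      (maxn (n - k + 1) (2 * t + 3) <= dz)%N &
      (minn (n - k + 1) (2 * t + 3) <= dx)%N].
Proof.
have row_module0 m (G : 'M[{poly F}]_(m, n)) : row_module G 0.
  by exists 0; rewrite mul0mx.
have [d1 hd1 ld1] : exists2 d,
    is_min_weight (fun v => dual (row_module B) v /\ ~ row_module A v) d & (n - k + 1 <= d)%N.
  apply: min_weight_exists => // v [hv nv]; apply: distB => //.
  by apply/eqP => v0; apply: nv; rewrite v0.
have [d2 hd2 ld2] : exists2 d,
    is_min_weight (fun v => dual (row_module A) v /\ ~ row_module B v) d & (2 * t + 3 <= d)%N.
  apply: min_weight_exists => // v [hv nv]; apply: distA => //.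
  by apply/eqP => v0; apply: nv; rewrite v0.
exists (memory (stabilizer A B)), (maxn d1 d2), (minn d1 d2); split; [|lia..].
have basicS := basic_stabilizer basicA basicB.
have hmin m (T : 'M[{poly F}]_(m, n + n)) : basic T ->
    (forall v, row_module T v <-> row_module (stabilizer A B) v) ->
    (4 + e <= constraint_length T)%N.
  move=> bT hT.
  have [L hL] := encoder_det bb wA (oner_neq0 F) fA_lt gA_lt fA_inj gA_inj fgA.
  have N10 : -1 != 0 :> F by rewrite oppr_eq0 oner_neq0.
  have [L' hL'] := encoder_det bb' wB N10 fB_lt gB_lt fB_inj gB_inj fgB.
  have := constraint_length_min (block_mx L 0 0 L') basicS bT hT.
  by rewrite (stabilizer_det hL hL').
exists r, s, A, B; split=> //.
- by rewrite nE /k /r /s; lia.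
(* The lower bound is minimality applied to the stabilizer matrix itself. *)
- apply/eqP; rewrite eqn_leq hmin // andbT.
  apply: leq_trans (_ : 2 + (2 + e) <= _)%N; last by lia.
  by apply: constraint_length_stabilizer => // i; apply: row_degree_encoder.
- by exists d1, d2.
Qed.

End CSS.

(** * Words over the field and completion to biorthogonal bases *)

Section Hamming.
Variables (F : finFieldType) (n : nat).
Implicit Types (x y : 'rV[F]_n).

Lemma hammingE x : hamming x = #|[set j | x ord0 j != 0]|.
Proof.
rewrite -sum1_card big_mkcond; apply: eq_bigr => j _.
by rewrite inE; case: (x ord0 j != 0).
Qed.

Lemma dot_single x y j0 : (forall j, j != j0 -> x ord0 j * y ord0 j = 0) ->
  dot x y = x ord0 j0 * y ord0 j0.
Proof. by move=> h; rewrite /dot (bigD1 j0) //= big1 ?addr0 // => j /h. Qed.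

Lemma dotDZ x y y' (c : F) : dot x (y + c *: y') = dot x y + c * dot x y'.
Proof.
rewrite /dot mulr_sumr -big_split; apply: eq_bigr => j _ /=.
by rewrite !mxE mulrDr mulrCA.
Qed.

Lemma row_neq0 x : x != 0 -> exists j, x ord0 j != 0.
Proof.
move=> x0; apply/existsP; rewrite -[X in is_true X]negbK negb_exists; apply/negP => /forallP h.
by case/eqP: x0; apply/rowP=> j; rewrite mxE; apply/eqP; rewrite -[_ == _]negbK h.
Qed.

Lemma extend_basis k zeta (G : 'M[F]_(k, n)) : n = (k + zeta)%N -> row_free G ->
  exists b b' : nat -> 'rV[F]_n,
  [/\ biorthogonal b b', forall i : 'I_k, b i = row i G &
      forall x, x = \sum_(j < n) dot x (b' j) *: b j].
Proof.
move=> nE; subst n => /eqP rG.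
(* The last [zeta] rows of [row_ebase G] span a complement of the row space of [G]. *)
pose M := col_mx G (row_mx 0 1%:M *m row_ebase G).
have uM : M \in unitmx.
  have -> : M = block_mx (col_ebase G) 0 0 1%:M *m row_ebase G.
    by rewrite /M -{1}(mulmx_ebase G) rG pid_mx_row mul_mx_row mulmx1 mulmx0 -mul_col_mx.
  by rewrite unitmx_mul row_ebase_unit andbT unitmxE det_ublock det1 mulr1 -unitmxE col_ebase_unit.
(* The rows of the inverse transpose form the dual basis. *)
pose W := (invmx M)^T.
pose rw (X : 'M[F]_(k + zeta)) (i : nat) : 'rV_(k + zeta) := if insub i is Some o then row o X else 0.
have rwE X (i : 'I_(k + zeta)) : rw X i = row i X by rewrite /rw valK.
have dotE (x : 'rV[F]_(k + zeta)) j : dot x (row j W) = (x *m invmx M) ord0 j.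
  by rewrite mxE; apply: eq_bigr => l _; rewrite !mxE.
exists (rw M), (rw W); split.
- move=> i j hi hj; rewrite (rwE M (Ordinal hi)) (rwE W (Ordinal hj)) dotE.
  by rewrite -row_mul mulmxV // !mxE.
- by move=> i; rewrite (rwE M (lshift zeta i)); apply/rowP=> j; rewrite [LHS]mxE col_mxEu mxE.
- move=> x; rewrite -[LHS]mulmx1 -(mulVmx uM) mulmxA mulmx_sum_row.
  by apply: eq_bigr => j _; rewrite !rwE dotE.
Qed.

End Hamming.

(** * Evaluation codes on the projective line and their duals *)

Section ProjectiveLine.
Variables (F : finFieldType) (n : nat) (pt : 'I_n -> option F).
Hypothesis pt_inj : injective pt.
Implicit Types p q : {poly F}.

(* The polynomial p, of size at most d.+1, stands for the form of degree d that it is the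
   dehomogenization of; None is the point at infinity. *)
Definition ev (d : nat) p : 'rV[F]_n :=
  \row_j if pt j is Some a then p.[a] else p`_d.

Lemma evDZ d p q c : ev d (p + c *: q) = ev d p + c *: ev d q.
Proof.
by apply/rowP=> j; rewrite !mxE; case: (pt j) => [a|]; rewrite ?(hornerD, hornerZ) ?(coefD, coefZ).
Qed.

Lemma ev0 d : ev d 0 = 0.
Proof. by apply/rowP=> j; rewrite !mxE; case: (pt j) => [a|]; rewrite ?horner0 ?coef0. Qed.

Lemma ev_sum (I : Type) (l : seq I) d (c : I -> F) (P : I -> {poly F}) :
  ev d (\sum_(i <- l) c i *: P i) = \sum_(i <- l) c i *: ev d (P i).
Proof.
elim: l => [|i l IH]; first by rewrite !big_nil ev0.
by rewrite !big_cons addrC evDZ IH addrC.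
Qed.

Lemma coef_mul_top p q a c : (size p <= a.+1)%N -> (size q <= c.+1)%N ->
  (p * q)`_(a + c) = p`_a * q`_c.
Proof.
move=> hp hq; have ha : (a < (a + c).+1)%N by lia.
rewrite coefM (bigD1 (Ordinal ha)) //= addKn big1 ?addr0 // => i.
rewrite -val_eqE /= => ia; have [lt|le] := ltnP i a.
  by rewrite [q`__]nth_default ?mulr0 //; apply: leq_trans hq _; lia.
by rewrite [p`__]nth_default ?mul0r //; apply: leq_trans hp _; lia.
Qed.

Lemma ev_mul a c p q j : (size p <= a.+1)%N -> (size q <= c.+1)%N ->
  ev (a + c) (p * q) ord0 j = ev a p ord0 j * ev c q ord0 j.
Proof.
by move=> hp hq; rewrite !mxE; case: (pt j) => [x|]; rewrite ?hornerM ?coef_mul_top.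
Qed.

Lemma size_finite_points (l : seq 'I_n) : uniq l ->
  (size (pmap id (map pt l)) + (None \in map pt l) = size l)%N.
Proof.
move=> ul; rewrite size_pmap -(size_map pt) -(count_predC isSome (map pt l)).
rewrite -count_uniq_mem ?map_inj_uniq //; congr (_ + _)%N.
by apply: eq_count => -[].
Qed.

Lemma finite_points_uniq (l : seq 'I_n) : uniq l -> uniq (pmap id (map pt l)).
Proof. by move=> ul; apply: (@pmap_uniq _ _ id Some) => [[]//|]; rewrite map_inj_uniq. Qed.

Lemma mem_finite_points (l : seq 'I_n) a : (a \in pmap id (map pt l)) = (Some a \in map pt l).
Proof. by rewrite mem_pmap map_id. Qed.

(** A nonzero form of degree d has at most d zeros: the finite ones are roots of [p], and a zero at
    infinity lowers the degree of [p]. *)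
Lemma hamming_ev d p : p != 0 -> (size p <= d.+1)%N -> (n - d <= hamming (ev d p))%N.
Proof.
move=> p0 hp; rewrite hammingE; set S := [set j | _].
suff hS : (#|~: S| <= d)%N.
  by rewrite leq_subLR -[X in (X <= _)%N]card_ord -(cardsC S) addnC leq_add2r.
set l := enum (~: S); rewrite cardE -/l -size_finite_points ?enum_uniq //.
have mem_l j : j \in map pt l -> exists2 i, pt i = j & ev d p ord0 i = 0.
  by move=> /mapP[i]; rewrite mem_enum !inE negbK => /eqP e ->; exists i.
have ltp : (size (pmap id (map pt l)) < size p)%N.
  apply: max_poly_roots => //; last by rewrite finite_points_uniq ?enum_uniq.
  apply/allP=> a; rewrite mem_finite_points => /mem_l[i hi].
  by rewrite mxE hi => e; apply/rootP.
case: (boolP (None \in _)) => [/mem_l[i hi]|_] /=; last first.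
  by rewrite addn0 -ltnS (leq_trans ltp).
rewrite mxE hi => e; suff : (size p <= d)%N by rewrite addn1; apply: leq_trans.
rewrite leqNgt; apply/negP => h; have sp : size p = d.+1 by lia.
by move: p0; rewrite -lead_coef_eq0 lead_coefE sp /= e eqxx.
Qed.

(** If the support had at most d+1 points, a form of degree d vanishing at all of them except [j0]
    would have a nonzero product with [x]. *)
Lemma hamming_dual_ev d (x : 'rV[F]_n) : x != 0 ->
  (forall p, (size p <= d.+1)%N -> dot x (ev d p) = 0) -> (d.+2 <= hamming x)%N.
Proof.
move=> x0 hx; rewrite leqNgt; apply/negP; rewrite hammingE.
set S := [set j | _] => hS; have [j0 hj0] := row_neq0 x0.
set l := enum (S :\ j0).
have sl : (size l <= d)%N by move: hS; rewrite /l -cardE (cardsD1 j0) inE hj0; lia.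
have ul : uniq l by rewrite enum_uniq.
have mem_l j : (pt j \in map pt l) = (j != j0) && (x ord0 j != 0).
  by rewrite mem_map // mem_enum !inE.
pose s := pmap id (map pt l).
pose P : {poly F} := \prod_(a <- s) ('X - a%:P).
have sP : size P = (size s).+1 by rewrite size_prod_XsubC.
have ss_le : (size s <= d)%N.
  by apply: leq_trans sl; rewrite -(size_finite_points ul) leq_addr.
have ss_lt : None \in map pt l -> (size s < d)%N.
  by move=> h; apply: leq_trans sl; rewrite -(size_finite_points ul) h addn1.
have Pmonic : P \is monic by rewrite monic_prod_XsubC.
have Proot a : root P a = (Some a \in map pt l) by rewrite root_prod_XsubC mem_finite_points.
(* If [j0] is infinity, the power of X brings the degree to exactly d, so the form is nonzero there.
   If infinity is in [l], then [P] has degree below d and vanishes there. *)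
pose p := if pt j0 is Some _ then P else 'X^(d - size s) * P.
have sp : (size p <= d.+1)%N.
  rewrite /p; case: (pt j0) => [_|]; first by rewrite sP ltnS.
  by rewrite mulrC size_mulXn ?monic_neq0 // sP addnS subnK.
have e : dot x (ev d p) = x ord0 j0 * ev d p ord0 j0.
  apply: dot_single => j jj0; have [->|xj] := eqVneq (x ord0 j) 0; first by rewrite mul0r.
  have := mem_l j; rewrite jj0 xj mxE /=; case ej : (pt j) => [a|] hl.
    have /rootP Pa : root P a by rewrite Proot.
    by rewrite /p; case: (pt j0) => [_|]; rewrite ?hornerM Pa !mulr0.
  have : pt j0 != None by rewrite -ej; apply: contra jj0 => /eqP/pt_inj->.
  rewrite /p; case: (pt j0) => // _ _; rewrite nth_default ?mulr0 // sP.
  exact: ss_lt.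
have := hx p sp; rewrite e => /eqP; rewrite mulf_eq0 (negbTE hj0) mxE /p /=.
have := mem_l j0; rewrite eqxx; case: (pt j0) => [a|] /= hl.
  by move: (Proot a); rewrite hl rootE => ->.
rewrite -[X in _`_X](subnK ss_le).
rewrite coef_mul_top ?size_polyXn ?sP // coefXn eqxx mul1r.
by move/monicP: Pmonic; rewrite lead_coefE sP /= => ->; rewrite oner_eq0.
Qed.

(** Scaling each coordinate by the nonzero value of [g] keeps the weight and turns orthogonality to
    g V_d into orthogonality to V_d. *)
Lemma hamming_scaled_dual_ev a d (g : {poly F}) (x : 'rV[F]_n) : (size g <= a.+1)%N ->
  (forall j, ev a g ord0 j != 0) -> x != 0 ->
  (forall p, (size p <= d.+1)%N -> dot x (ev (a + d) (g * p)) = 0) ->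
  (d.+2 <= hamming x)%N.
Proof.
move=> sg g0 x0 hx; pose y := \row_j (x ord0 j * ev a g ord0 j).
have -> : hamming x = hamming y.
  by apply: eq_bigr => j _; rewrite [y _ _]mxE mulf_eq0 (negbTE (g0 j)) orbF.
apply: hamming_dual_ev.
  have [j hj] := row_neq0 x0; apply/eqP => /rowP/(_ j).
  by rewrite [y _ _]mxE [RHS]mxE => /eqP; rewrite mulf_eq0 (negbTE hj) (negbTE (g0 j)).
move=> p hp; rewrite -[RHS](hx p hp); apply: eq_bigr => j _.
by rewrite ev_mul // [y _ _]mxE mulrA.
Qed.

End ProjectiveLine.

(** * Spanning by degrees, and a quadratic without roots *)

Lemma poly_staircase (F : fieldType) (S : {poly F} -> Prop) (k : nat) :
  (forall p q c, S p -> S q -> S (p + c *: q)) -> S 0 ->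
  (forall i, (i < k)%N -> exists2 p, S p & size p = i.+1) ->
  forall p : {poly F}, (size p <= k)%N -> S p.
Proof.
move=> lin S0; elim: k => [|k IH] h p hp.
  by move: hp; rewrite size_poly_leq0 => /eqP->.
have [g Sg sg] := h k (ltnSn k).
have gk : g`_k != 0 by rewrite -[k]/(k.+1.-1) -sg -lead_coefE lead_coef_eq0 -size_poly_eq0 sg.
(* The subtracted multiple of [g] cancels the coefficient of X^k, leaving size at most k. *)
have -> : p = p - (p`_k / g`_k) *: g + (p`_k / g`_k) *: g by rewrite subrK.
apply: lin Sg; apply: IH => [i hi|]; first by apply: h; lia.
apply/leq_sizeP=> j; rewrite leq_eqVlt => /predU1P[<-|hj].
  by rewrite coefB coefZ mulfVK // subrr.
by rewrite coefB coefZ (nth_default _ (leq_trans hp hj)) [g`_j]nth_default ?sg // mulr0 subr0.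
Qed.

(** The map a -> a^2 + a sends both 0 and -1 to 0, so on a finite field it is not surjective; a
    missed value c gives N = X^2 + X - c. *)
Lemma rootless_quadratic (F : finFieldType) :
  exists2 N : {poly F}, N \is monic /\ size N = 3 & forall a, N.[a] != 0.
Proof.
have [/forallP h|] := boolP [forall c : F, exists a : F, a ^+ 2 + a == c].
  have h' c : exists a : F, a ^+ 2 + a == c by apply/existsP/h.
  pose g c := xchoose (h' c); have gK c : g c ^+ 2 + g c = c by apply/eqP/(xchooseP (h' c)).
  have /injF_bij[f gf fg] : injective g by move=> c c' e; rewrite -(gK c) e gK.
  have fE a : f a = a ^+ 2 + a by rewrite -{2 3}(fg a) gK.
  have : (0 : F) = -1 by rewrite -(fg 0) -(fg (-1)) !fE; congr g; ring.
  by move/eqP; rewrite eq_sym oppr_eq0 oner_eq0.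
rewrite negb_forall => /existsP[c]; rewrite negb_exists => /forallP hc.
have sq : (size ('X - c%:P : {poly F})%R < size ('X^2 : {poly F})%R)%N.
  by rewrite size_XsubC size_polyXn.
exists ('X^2 + ('X - c%:P)) => [|a].
  rewrite size_polyDl // size_polyXn; split=> //.
  by rewrite monicE lead_coefDl // lead_coefXn.
by rewrite hornerD hornerXn hornerXsubC addrA subr_eq0.
Qed.

(** * Generators adapted to the chain of nested codes *)

Section NestedCodes.
Variables (F : finFieldType) (n t m : nat) (pt : 'I_n -> option F) (N : {poly F}).
Hypothesis t0 : (0 < t)%N.
Let d := (2 * m + (2 * t + 1))%N.
Local Notation ev := (ev pt).

(* The generators 2t and 2t+1 complete N^(m+1) V_(2t-1) to N^m V_(2t+1), where V_c denotes the
   forms of degree c. The summand N X^(2t-1) is there to make the last one nonzero at infinity,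
   where N^m vanishes. *)
Definition nested_generator (j : nat) : {poly F} :=
  if (j < 2 * t)%N then N ^+ m.+1 * 'X^j
  else if j == (2 * t)%N then N ^+ m
  else if j == (2 * t + 1)%N then N ^+ m * ('X + N * 'X^(2 * t - 1))
  else 'X^(j - (2 * t + 2)).

Lemma nested_generator_low j : (j < 2 * t)%N -> nested_generator j = N ^+ m.+1 * 'X^j.
Proof. by rewrite /nested_generator => ->. Qed.

Lemma nested_generator_even : nested_generator (2 * t) = N ^+ m.
Proof. by rewrite /nested_generator ltnn eqxx. Qed.

Lemma nested_generator_odd :
  nested_generator (2 * t + 1) = N ^+ m * ('X + N * 'X^(2 * t - 1)).
Proof. by rewrite /nested_generator; do ?[case: ifP => ?] => //; lia. Qed.

Lemma nested_generator_high j : nested_generator (j + (2 * t + 2)) = 'X^j.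
Proof. by rewrite /nested_generator addnK; do ?[case: ifP => ?] => //; lia. Qed.

Hypotheses (Nmonic : N \is monic) (sN : size N = 3) (N0 : forall a, N.[a] != 0).

Lemma size_normX a : size (N ^+ a) = (2 * a).+1.
Proof.
have := size_exp N a; rewrite sN /= => h.
have : (0 < size (N ^+ a)%R)%N by rewrite size_poly_gt0 expf_neq0 // monic_neq0.
by move: h; case: size => //= ? -> _; rewrite mulnC.
Qed.

Lemma size_normM a (p : {poly F}) : p != 0 -> size (N ^+ a * p) = (2 * a + size p)%N.
Proof. by move=> p0; rewrite size_monicM ?monic_exp // size_normX. Qed.

Lemma size_normM_leq a c (p : {poly F}) : (size p <= c)%N ->
  (size (N ^+ a * p)%R <= 2 * a + c)%N.
Proof.
move=> hp; have [->|p0] := eqVneq p 0; first by rewrite mulr0 size_poly0.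
by rewrite size_normM // leq_add2l.
Qed.

Lemma ev_norm_neq0 a j : ev (2 * a) (N ^+ a) ord0 j != 0.
Proof.
rewrite mxE; case: (pt j) => [x|]; first by rewrite horner_exp expf_neq0.
have /monicP : N ^+ a \is monic by rewrite monic_exp.
by rewrite lead_coefE size_normX /= => ->; rewrite oner_neq0.
Qed.

Let sNt : size ('X + N * 'X^(2 * t - 1)) = (2 * t + 2)%N.
Proof.
rewrite addrC size_polyDl size_mulXn ?monic_neq0 // sN ?size_polyX; lia.
Qed.

Lemma size_nested_generator j : (j < d.+1)%N -> (size (nested_generator j) <= d.+1)%N.
Proof.
rewrite /nested_generator /d => hj; case: ifP => h1.
  by apply: leq_trans (@size_normM_leq m.+1 j.+1 _ _) _; rewrite ?size_polyXn //; lia.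
case: ifP => h2; first by rewrite size_normX; lia.
case: ifP => h3; last by rewrite size_polyXn; lia.
by apply: leq_trans (@size_normM_leq m (2 * t + 2) _ _) _; rewrite ?sNt //; lia.
Qed.

Variable S : {poly F} -> Prop.
Hypothesis S_lin : forall p q c, S p -> S q -> S (p + c *: q).
Hypothesis S0 : S 0.

(** After removal of N^m the generators yield 1, X and N X^i, one polynomial of each degree. The
    subspace [S] serves both for orthogonality to a word and for membership in a row space. *)
Lemma nested_span_norm :
  (forall j, (j < 2 * t + 2)%N -> S (nested_generator j)) ->
  forall p : {poly F}, (size p <= 2 * t + 2)%N -> S (N ^+ m * p).
Proof.
move=> hS; apply: poly_staircase; [|by rewrite mulr0|].
  by move=> p q c hp hq; rewrite mulrDr -scalerAr; apply: S_lin.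
have hlow j : (j < 2 * t)%N -> S (N ^+ m * (N * 'X^j)).
  move=> hj; rewrite mulrA -exprSr -nested_generator_low //; apply: hS; lia.
case=> [|[|i]] hi.
- exists 1; last by rewrite size_poly1.
  by rewrite mulr1 -nested_generator_even; apply: hS; lia.
- exists 'X; last by rewrite size_polyX.
  have hX : S (N ^+ m * ('X + N * 'X^(2 * t - 1))).
    by rewrite -nested_generator_odd; apply: hS; lia.
  (* Subtracting the low generator N^(m+1) X^(2t-1) isolates N^m X. *)
  have := S_lin (-1) hX (hlow (2 * t - 1)%N _).
  by rewrite mulrDr scaleN1r addrK; apply; lia.
exists (N * 'X^i); first by apply: hlow; lia.
by rewrite size_mulXn ?monic_neq0 // sN addnC.
Qed.

(** Degrees below 2m come from the monomial generators, the others from N^m X^(i-2m). *)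
Lemma nested_span :
  (forall j, (j < d.+1)%N -> S (nested_generator j)) ->
  forall p : {poly F}, (size p <= d.+1)%N -> S p.
Proof.
move=> hS; apply: poly_staircase => // i; rewrite /d => hi.
have [lt|ge] := ltnP i (2 * m).
  exists 'X^i; last by rewrite size_polyXn.
  by rewrite -nested_generator_high; apply: hS; rewrite /d; lia.
exists (N ^+ m * 'X^(i - 2 * m)).
  apply: nested_span_norm => [j hj|]; last by rewrite size_polyXn; lia.
  by apply: hS; rewrite /d; lia.
by rewrite size_normM ?monic_neq0 ?monicXn // size_polyXn; lia.
Qed.

Lemma nested_span_low :
  (forall j, (j < 2 * t)%N -> S (nested_generator j)) ->
  forall p : {poly F}, (size p <= 2 * t)%N -> S (N ^+ m.+1 * p).
Proof.
move=> hS; apply: poly_staircase; [|by rewrite mulr0|].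
  by move=> p q c hp hq; rewrite mulrDr -scalerAr; apply: S_lin.
move=> i hi; exists 'X^i; last by rewrite size_polyXn.
by rewrite -nested_generator_low //; apply: hS.
Qed.

End NestedCodes.

(** * Dual distances and independence of the generators *)

Section NestedDistances.
Variables (F : finFieldType) (n t m : nat) (pt : 'I_n -> option F) (N : {poly F}).
Hypotheses (pt_inj : injective pt) (t0 : (0 < t)%N).
Hypotheses (Nmonic : N \is monic) (sN : size N = 3) (N0 : forall a, N.[a] != 0).
Let d := (2 * m + (2 * t + 1))%N.
Local Notation ev := (ev pt).
Local Notation gen := (nested_generator t m N).

Let dot_lin (x : 'rV[F]_n) p q c :
  dot x (ev d p) = 0 -> dot x (ev d q) = 0 -> dot x (ev d (p + c *: q)) = 0.
Proof. by move=> hp hq; rewrite evDZ dotDZ hp hq mulr0 addr0. Qed.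

Let dot0 (x : 'rV[F]_n) : dot x (ev d 0) = 0.
Proof. by rewrite ev0 /dot big1 // => j _; rewrite mxE mulr0. Qed.

(** N^m has no zero on the projective line, so up to scaling [x] is in the dual of V_(2t+1). *)
Lemma nested_dual_distance (x : 'rV[F]_n) : x != 0 ->
  (forall j, (j < 2 * t + 2)%N -> dot x (ev d (gen j)) = 0) -> (2 * t + 3 <= hamming x)%N.
Proof.
move=> x0 hx; rewrite (_ : 2 * t + 3 = (2 * t + 1).+2)%N; last by lia.
apply: (hamming_scaled_dual_ev pt_inj (a := 2 * m) (g := N ^+ m)) => //.
- by rewrite size_normX.
- exact: ev_norm_neq0.
move=> p hp; apply: (nested_span_norm (S := fun p => dot x (ev d p) = 0) t0 Nmonic sN) => //.
  by move=> p' q' c; apply: dot_lin.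
by rewrite (_ : 2 * t + 2 = (2 * t + 1).+1)%N //; lia.
Qed.

Lemma nested_dual_distance_low (x : 'rV[F]_n) : x != 0 ->
  (forall j, (j < 2 * t)%N -> dot x (ev d (gen j)) = 0) -> (2 * t + 1 <= hamming x)%N.
Proof.
move=> x0 hx; rewrite (_ : 2 * t + 1 = (2 * t - 1).+2)%N; last by lia.
apply: (hamming_scaled_dual_ev pt_inj (a := 2 * m.+1) (g := N ^+ m.+1)) => //.
- by rewrite size_normX.
- exact: ev_norm_neq0.
move=> p hp; rewrite (_ : 2 * m.+1 + (2 * t - 1) = d)%N; last by rewrite /d; lia.
apply: (nested_span_low (S := fun p => dot x (ev d p) = 0) (t := t)) => //.
  by move=> p' q' c; apply: dot_lin.
by rewrite (_ : 2 * t = (2 * t - 1).+1)%N //; lia.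
Qed.

(** A word of weight 1 would give a common zero of the two generators; but the first has no finite
    zero, and the second has degree exactly d and so is nonzero at infinity. *)
Lemma nested_dual_distance_high (x : 'rV[F]_n) : x != 0 ->
  dot x (ev d (gen (2 * t)%N)) = 0 -> dot x (ev d (gen (2 * t + 1)%N)) = 0 ->
  (2 <= hamming x)%N.
Proof.
move=> x0; have [j0 hj0] := row_neq0 x0.
rewrite nested_generator_even nested_generator_odd // => h1 h2.
rewrite ltnNge; apply/negP => hle.
have hz j : j != j0 -> x ord0 j = 0.
  move=> jj0; apply/eqP/negPn/negP => xj; move: hle; rewrite /hamming.
  by rewrite (bigD1 j0) //= (bigD1 j) //= hj0 xj.
move: h1 h2; rewrite !(dot_single (j0 := j0)) => [/eqP|j /hz->|j /hz->]; rewrite ?mul0r //.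
rewrite mulf_eq0 (negbTE hj0) /= => h1 /eqP; rewrite mulf_eq0 (negbTE hj0) /=.
have sNm : (size (N ^+ m)%R <= (2 * m).+1)%N.
  by rewrite size_normX.
have sNX : size (N * 'X^(2 * t - 1)) = (2 * t + 2)%N.
  by rewrite size_mulXn ?monic_neq0 // sN; lia.
have sq : (size ('X + N * 'X^(2 * t - 1))%R <= (2 * t + 1).+1)%N.
  by rewrite (leq_trans (size_polyD _ _)) // sNX size_polyX geq_max; apply/andP; split; lia.
rewrite /d (ev_mul _ _ sNm sq) mulf_eq0 (negbTE (ev_norm_neq0 pt Nmonic sN N0 m j0)) //=.
move: h1; rewrite !mxE; case: (pt j0) => [a|_].
  by rewrite horner_exp expf_eq0 (negbTE (N0 a)) andbF.
rewrite coefD coefX (_ : (_ == 1)%N = false) ?add0r; last by lia.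
have /monicP : N * 'X^(2 * t - 1) \is monic by rewrite monicMl ?monicXn.
rewrite lead_coefE sNX (_ : (2 * t + 2).-1 = 2 * t + 1)%N; last by lia.
by move=> ->; rewrite oner_eq0.
Qed.

(** The generators span the evaluations of the d+1 monomials, which are independent since a nonzero
    form of degree d < n has positive weight; equality of numbers gives the independence of the
    generators. *)
Lemma nested_row_free : (d < n)%N -> row_free (\matrix_(i < d.+1) ev d (gen i)).
Proof.
move=> dn; set G := \matrix_i _.
pose V : 'M[F]_(d.+1, n) := \matrix_(i < d.+1) ev d 'X^i.
have VG : (V <= G)%MS.
  apply/row_subP=> i; rewrite rowK.
  apply: (nested_span (S := fun p => is_true (ev d p <= G)%MS) (t := t) (m := m) t0 Nmonic sN).
  - by move=> p q c hp hq; rewrite evDZ addmx_sub ?scalemx_sub.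
  - by rewrite ev0 sub0mx.
  - by move=> j hj; have := row_sub (Ordinal hj) G; rewrite rowK.
  - by rewrite size_polyXn.
have rV : row_free V.
  rewrite -kermx_eq0; apply/rowV0P => v /sub_kermxP vV.
  pose p := \poly_(i < d.+1) (if insub i is Some o then v ord0 o else 0).
  have pE (i : 'I_d.+1) : p`_i = v ord0 i by rewrite coef_poly ltn_ord valK.
  have evp : ev d p = 0.
    rewrite -vV mulmx_sum_row /p poly_def ev_sum; apply: eq_bigr => i _.
    by rewrite rowK valK.
  suff p0 : p = 0 by apply/rowP=> i; rewrite -pE p0 coef0 mxE.
  apply/eqP/negPn/negP => /(hamming_ev pt_inj) /(_ (size_poly _ _)).
  by rewrite evp /hamming big1 => [|j _]; [lia | rewrite mxE eqxx].
by rewrite /row_free eqn_leq rank_leq_row -{1}(eqP rV) mxrankS.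
Qed.

End NestedDistances.

(** * Codes on the projective line and the two parameter families *)

Lemma projective_line_css (F : finFieldType) (n t e rho m zeta : nat) :
  n = #|F|.+1 -> (0 < t)%N -> (0 < e + rho)%N -> (2 * e + rho = 2 * m)%N ->
  n = (2 * m + 2 * t + 2 + zeta)%N ->
  exists mu dz dx : nat,
  [/\ AQCC_exists F n (e + rho) mu (4 + e) dz dx,
      (maxn (n - (2 * m + 2 * t + 2) + 1) (2 * t + 3) <= dz)%N &
      (minn (n - (2 * m + 2 * t + 2) + 1) (2 * t + 3) <= dx)%N].
Proof.
move=> nF t0 K0 em nE.
have nO : n = #|{: option F}| by rewrite card_option.
pose pt (j : 'I_n) : option F := enum_val (cast_ord nO j).
have pt_inj : injective pt by move=> i j /enum_val_inj/cast_ord_inj.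
have [N [Nmonic sN] N0] := rootless_quadratic F.
pose d := (2 * m + (2 * t + 1))%N; pose gen := nested_generator t m N.
have nE' : n = (d.+1 + zeta)%N by rewrite nE /d; lia.
have dn : (d < n)%N by rewrite nE'; lia.
have [b [b' [bb bE bexp]]] := extend_basis nE' (nested_row_free pt_inj t0 Nmonic sN dn).
have {}bE j : (j < d.+1)%N -> b j = ev pt d (gen j).
  by move=> hj; rewrite (bE (Ordinal hj)) rowK.
rewrite (_ : 2 * m + 2 * t + 2 = 2 * t + 2 + 2 * e + rho)%N; last by lia.
apply: (css_code (zeta := zeta) (b := b) (b' := b')) => //.
- by rewrite nE; lia.
- move=> x x0 hx.
  (* Orthogonality to b'_z for z > d leaves only b_0, ..., b_d in the expansion of [x], which is
     thus the evaluation of a form of degree d. *)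
  have xE : x = ev pt d (\sum_(j < n | (j < d.+1)%N) dot x (b' j) *: gen j).
    rewrite -big_filter ev_sum big_filter [LHS]bexp (bigID (fun j : 'I_n => (j < d.+1)%N)) /=.
    rewrite [X in _ + X]big1 ?addr0 => [|j hj]; last first.
      by rewrite hx ?scale0r // ltn_ord andbT; move: hj; rewrite /d; lia.
    by apply: eq_bigr => j hj; rewrite bE.
  rewrite [in leqRHS]xE (_ : _ - _ + 1 = n - d)%N; last by move: dn; rewrite /d; lia.
  apply: hamming_ev => //.
    by apply/eqP => p0; move: x0; rewrite xE p0 ev0 eqxx.
  apply: (leq_trans (size_sum _ _ _)); apply/bigmax_leqP=> j hj.
  by apply: (leq_trans (size_scale_leq _ _)); apply: size_nested_generator.
- move=> x x0 hx; apply: (nested_dual_distance (m := m) pt_inj t0 Nmonic sN) => // j hj.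
  by rewrite -bE ?hx //; rewrite /d; lia.
- move=> x x0 hx; apply: (nested_dual_distance_low (m := m) pt_inj t0 Nmonic sN) => // j hj.
  by rewrite -bE ?hx //; rewrite /d; lia.
- move=> x x0 h1 h2; apply: (nested_dual_distance_high (m := m) (pt := pt) t0 Nmonic sN) => //.
    by rewrite -bE ?h1 //; rewrite /d; lia.
  by rewrite -bE ?h2 //; rewrite /d; lia.
Qed.

Local Close Scope ring_scope.

Theorem theorem3p5 (l : nat) (hl : 4 <= l) (F : finFieldType) (hF : #|F| = 2 ^ l) :
  let q := 2 ^ l in
  let n := q + 1 in
  let a := q %/ 2 in
  (forall i t : nat, 0 < i -> 0 < t ->
     1 <= t <= i - 2 -> 3 <= i <= a - 1 ->
     exists mu dz dx : nat,
       [/\ AQCC_exists F n (2 * i - 2 * t - 2) mu 6 dz dx,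
           maxn (n - 2 * i - 1) (2 * t + 3) <= dz &
           minn (n - 2 * i - 1) (2 * t + 3) <= dx])
  /\
  (forall i t : nat, 0 < i -> 0 < t ->
     1 <= t <= i - 1 -> 2 <= i <= a - 1 ->
     exists mu dz dx : nat,
       [/\ AQCC_exists F n (2 * i - 2 * t) mu 4 dz dx,
           maxn (n - 2 * i - 1) (2 * t + 3) <= dz &
           minn (n - 2 * i - 1) (2 * t + 3) <= dx]).
Proof.
move=> q n a; have nF : n = #|F|.+1 by rewrite hF /n addn1.
have nE i : i <= a - 1 -> 0 < i -> 2 * i + 2 <= n.
  by rewrite /a /n; move: (q) => q'; lia.
split=> i t i0 t0 ti ia; have {}ia : 2 * i + 2 <= n by apply: nE => //; lia.
(* Here e = 2 and rho = 2(i - t) - 4, so the degree is 6; t <= i - 2 makes the subtraction exact. *)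
- have -> : 2 * i - 2 * t - 2 = 2 + (2 * i - 2 * t - 4) by lia.
  have -> : n - 2 * i - 1 = n - (2 * (i - t) + 2 * t + 2) + 1 by lia.
  by apply: (@projective_line_css _ _ _ 2 _ _ (n - (2 * i + 2)) nF) => //; lia.
(* Here e = 0 and rho = 2(i - t), positive because t < i; the degree is 4. *)
- have -> : 2 * i - 2 * t = 0 + (2 * i - 2 * t) by lia.
  have -> : n - 2 * i - 1 = n - (2 * (i - t) + 2 * t + 2) + 1 by lia.
  by apply: (@projective_line_css _ _ _ 0 _ _ (n - (2 * i + 2)) nF) => //; lia.
Qed.
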